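(* If $\mathcal{S}\subseteq\mathcal{L}(H)$ is a non-commutative graph (operator system) on a finite dimensional complex Hilbert space $H$, then $$\alpha(\mathcal{S}) \le \theta(\mathcal{S}) \le \varphi(\mathcal{S}).$$
   Context: $\mathcal{L}(H)$ is the algebra of all linear operators on $H$; $\mathcal{L}(H)^+$ is its cone of positive semidefinite operators. An operator system, or non-commutative graph, in $\mathcal{L}(H)$ is a linear subspace $\mathcal{S}$ with $I\in\mathcal{S}$ and $A^*\in\mathcal{S}$ whenever $A\in\mathcal{S}$. ''Projection'' means orthogonal projection. A projection $P\in\mathcal{L}(H)$ is $\mathcal{S}$-abelian if $P\mathcal{S}P$ is contained in an abelian C*-subalgebra of $\mathcal{L}(H)$; it is $\mathcal{S}$-full if $\mathcal{L}(PH)\oplus 0_{P^\perp}\subseteq\mathcal{S}$. For $\mathcal{C}\subseteq\mathcal{L}(H)$, $\mathrm{her}(\mathcal{C})=\{A\in\mathcal{L}(H)^+ : \exists B\in\mathcal{C},\ A\le B\}$. Set $\mathrm{ap}(\mathcal{S})=\mathrm{her}(\overline{\mathrm{conv}}\{P : P\ \mathcal{S}\text{-abelian projection}\})$ and $\mathrm{fp}(\mathcal{S})=\mathrm{her}(\overline{\mathrm{conv}}\{P : P\ \mathcal{S}\text{-full projection}\})$. For a non-empty $\mathcal{A}\subseteq\mathcal{L}(H)^+$, $\mathcal{A}^\sharp=\{B\in\mathcal{L}(H)^+ : \mathrm{Tr}(AB)\le 1\ \forall A\in\mathcal{A}\}$ and $\theta(\mathcal{A})=\sup\{\mathrm{Tr}(A):A\in\mathcal{A}\}\in[0,\infty]$.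 A quantum channel is a completely positive trace preserving linear map. If $\Phi:\mathcal{L}(H)\to M_k$ is completely positive with Kraus representation $\Phi(T)=\sum_{p=1}^mA_pTA_p^*$, put $\mathcal{S}_\Phi=\mathrm{span}\{A_p^*A_q : p,q=1,\dots,m\}$ (independent of the Kraus representation). Let $\mathfrak{C}(\mathcal{S})$ be the set of all quantum channels $\Phi:\mathcal{L}(H)\to M_k$, $k\in\mathbb{N}$ arbitrary, with $\mathcal{S}_\Phi\subseteq\mathcal{S}$, and $\mathrm{th}(\mathcal{S})=\{T\in\mathcal{L}(H)^+ : \Phi(T)\le I\text{ for every }\Phi\in\mathfrak{C}(\mathcal{S})\}$. Parameters: $\alpha(\mathcal{S})=\theta(\mathrm{ap}(\mathcal{S}))$, $\theta(\mathcal{S})=\theta(\mathrm{th}(\mathcal{S}))$, $\varphi(\mathcal{S})=\theta(\mathrm{fp}(\mathcal{S})^\sharp)$ (the latter may be $+\infty$). *)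

(* Defs.v *)
(* Non-commutative graphs on H = C^n, with L(H) = 'M[C]_n acting on column
   vectors, in MathComp and MathComp-Analysis. *)
From HB Require Import structures.
From mathcomp Require Import all_boot all_order all_algebra.
From mathcomp Require Import complex.
From mathcomp Require Import all_classical all_reals all_analysis.

Set Implicit Arguments.
Unset Strict Implicit.
Unset Printing Implicit Defensive.

Import Order.TTheory GRing.Theory Num.Theory numFieldNormedType.Exports.

Local Open Scope classical_set_scope.
Local Open Scope ring_scope.

(* Topologies on numeric fields are keyed on the sort of the structure, so
   R[i] itself carries none: Cfield R is R[i] packed as a numClosedFieldType, from
   which 'M[Cfield R]_n gets its (entrywise, i.e. norm) topology. *)
Definition Cfield (R : realType) : numClosedFieldType := R[i].

Section Operators.
Context {R : realType}.
Local Notation C := (Cfield R).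

Definition adj {m n} (A : 'M[C]_(m, n)) : 'M[C]_(n, m) := map_mx Num.conj A^T.

(* In C, 0 <= z entails that z is real; hence psd A entails adj A = A. *)
Definition psd {n} (A : 'M[C]_n) : Prop :=
  forall x : 'cV[C]_n, 0 <= (adj x *m A *m x) 0 0.

Definition loewner {n} (A B : 'M[C]_n) : Prop := psd (B - A).

Definition projection {n} (P : 'M[C]_n) : Prop := P *m P = P /\ adj P = P.

Definition operator_system {n} (S : {vspace 'M[C]_n}) : Prop :=
  1%:M \in S /\ forall A, A \in S -> adj A \in S.

(* The unit of a C*-subalgebra of L(H), if any, need not be the identity. *)
Definition cstar_subalgebra {n} (D : set 'M[C]_n) : Prop :=
  [/\ D 0,
      forall (a : C) A B, D A -> D B -> D (a *: A + B),
      forall A B, D A -> D B -> D (A *m B),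
      forall A, D A -> D (adj A)
    & closed D].

Definition abelian_algebra {n} (D : set 'M[C]_n) : Prop :=
  cstar_subalgebra D /\ forall A B, D A -> D B -> A *m B = B *m A.

Definition abelian_projection {n} (S : {vspace 'M[C]_n}) (P : 'M[C]_n) : Prop :=
  projection P /\
  exists2 D : set 'M[C]_n, abelian_algebra D &
    [set P *m A *m P | A in [set` S]] `<=` D.

(* The operators of L(PH) (+) 0 are the compressions P A P. *)
Definition full_projection {n} (S : {vspace 'M[C]_n}) (P : 'M[C]_n) : Prop :=
  projection P /\ [set P *m A *m P | A in [set: 'M[C]_n]] `<=` [set` S].

Definition conv {n} (X : set 'M[C]_n) : set 'M[C]_n :=
  [set A | exists (m : nat) (a : 'I_m -> C) (B : 'I_m -> 'M[C]_n),
     [/\ forall i, 0 <= a i, \sum_i a i = 1, forall i, X (B i)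
       & A = \sum_i a i *: B i]].

Definition her {n} (X : set 'M[C]_n) : set 'M[C]_n :=
  [set A | psd A /\ exists2 B, X B & loewner A B].

Definition ap {n} (S : {vspace 'M[C]_n}) : set 'M[C]_n :=
  her (closure (conv (abelian_projection S))).

Definition fp {n} (S : {vspace 'M[C]_n}) : set 'M[C]_n :=
  her (closure (conv (full_projection S))).

Definition sharp {n} (X : set 'M[C]_n) : set 'M[C]_n :=
  [set B | psd B /\ forall A, X A -> \tr (A *m B) <= 1].

(* The trace of a psd matrix is real. *)
Definition theta_set {n} (X : set 'M[C]_n) : \bar R :=
  ereal_sup [set (complex.Re (\tr A))%:E | A in X].

(* A positive element of M_m(L(H)) is a psd m x m block matrix; the
   amplification of Phi acts on it blockwise. *)
Definition completely_positive {n k} (Phi : 'M[C]_n -> 'M[C]_k) : Prop :=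
  forall (m : nat) (T : 'I_m -> 'I_m -> 'M[C]_n),
    psd (@mxblock C m m (fun=> n) (fun=> n) T) ->
    psd (@mxblock C m m (fun=> k) (fun=> k) (fun i j => Phi (T i j))).

Definition trace_preserving {n k} (Phi : 'M[C]_n -> 'M[C]_k) : Prop :=
  forall T, \tr (Phi T) = \tr T.

Definition quantum_channel {n k} (Phi : {linear 'M[C]_n -> 'M[C]_k}) : Prop :=
  completely_positive Phi /\ trace_preserving Phi.

Definition kraus_rep {n k m} (Phi : 'M[C]_n -> 'M[C]_k)
    (A : 'I_m -> 'M[C]_(k, n)) : Prop :=
  forall T, Phi T = \sum_p A p *m T *m adj (A p).

Definition kraus_space {n k m} (A : 'I_m -> 'M[C]_(k, n)) : {vspace 'M[C]_n} :=
  <<[seq adj (A p) *m A q | p <- enum 'I_m, q <- enum 'I_m]>>%VS.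

(* Every completely positive map has a Kraus representation, and all of them
   have the same kraus_space, which is S_Phi. *)
Definition channels {n} (S : {vspace 'M[C]_n}) (k : nat) :
    set {linear 'M[C]_n -> 'M[C]_k} :=
  [set Phi | quantum_channel Phi /\
     exists (m : nat) (A : 'I_m -> 'M[C]_(k, n)),
       kraus_rep Phi A /\ (kraus_space A <= S)%VS].

Definition th {n} (S : {vspace 'M[C]_n}) : set 'M[C]_n :=
  [set T | psd T /\
     forall (k : nat) (Phi : {linear 'M[C]_n -> 'M[C]_k}),
       channels S Phi -> loewner (Phi T) 1%:M].

Definition alpha {n} (S : {vspace 'M[C]_n}) : \bar R := theta_set (ap S).
Definition theta {n} (S : {vspace 'M[C]_n}) : \bar R := theta_set (th S).
Definition phi {n} (S : {vspace 'M[C]_n}) : \bar R := theta_set (sharp (fp S)).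

End Operators.

(* Main.v *)
Require Import Defs.
From HB Require Import structures.
From mathcomp Require Import all_boot all_order all_algebra.
From mathcomp Require Import all_classical all_reals all_analysis.
From mathcomp Require Import ring.

(** Both inequalities come from inclusions of sets of positive operators,
    [ap S `<=` th S `<=` sharp (fp S)], and each inclusion is reduced to a single
    projection. The reduction is [tr_her_closure_conv_le]: for [W >= 0], a bound
    [\tr (P *m W) <= c] on a set of operators [P] survives convex combinations,
    limits and passing to smaller operators. The condition [Phi A <= 1] is a family
    of such bounds, because [<x, Phi A x>] is the trace of [A] against the positive
    operator [kraus_dual B (x x^* )], for [B] a Kraus family of [Phi].

    First inclusion ([kraus_map_abelian_le1]). Let [P] be S-abelian and let [A] be a
    Kraus family of a channel whose Kraus space lies in [S]. The compressions
    [P A_p^* A_q P] commute and are permuted by the adjoint, so an orthonormal basis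
    diagonalizes all of them; let [Q_j] be the rank-one projections on its vectors.
    Then [Phi P] is the sum of the operators [rho_j = Phi (P Q_j P)], which are
    positive with trace at most 1. Since
    [rho_i rho_j = \sum_(p, q) A_p P (Q_i (P A_p^* A_q P) Q_j) P A_q^*], they are
    pairwise orthogonal, and a sum of such operators is at most 1
    ([sum_orthogonal_le1]).

    Second inclusion ([th_full_le1]). If [P] is S-full, the map
    [T |-> \tr (P T) (+) (1 - P) T (1 - P)] is a channel: it measures [P], and
    forgets the state when the answer is yes. Its Kraus space lies in [S], because it
    is spanned by operators [P X P] and by [1 - P]. So [T] in [th S] is sent below 1,
    and the corner entry of the image says [\tr (P *m T) <= 1]. *)

Import Order.TTheory GRing.Theory Num.Theory numFieldNormedType.Exports.

Set Implicit Arguments.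
Unset Strict Implicit.
Unset Printing Implicit Defensive.

Local Open Scope classical_set_scope.
Local Open Scope ring_scope.

(** * Sums of matrices and block matrices *)

Lemma sum_delta_mx (K : pzRingType) n : \sum_i delta_mx i i = 1%:M :> 'M[K]_n.
Proof. by rewrite scalar_mx_sum_delta; apply: eq_bigr => i _; rewrite scale1r. Qed.

Lemma sum_orthogonal_square (K : pzSemiRingType) n (I : finType)
    (A : I -> 'M[K]_n) :
    (forall i j, i != j -> A i *m A j = 0) ->
  (\sum_i A i) *m (\sum_i A i) = \sum_i A i *m A i.
Proof.
move=> orth; rewrite mulmx_suml; apply: eq_bigr => i _.
rewrite mulmx_sumr (bigD1 i) //= big1 ?addr0 // => j ij.
by rewrite orth // eq_sym.
Qed.

Lemma sum_ord_addn1 (V : nmodType) n (F : 'I_n + 'I_1 -> V) :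
  \sum_(p < n + 1) F (fintype.split p) = \sum_(i < n) F (inl i) + F (inr 0).
Proof.
rewrite big_split_ord big_ord1 (unsplitK (inr _)).
by congr (_ + _); apply: eq_bigr => i _; rewrite (unsplitK (inl _)).
Qed.

Lemma mul_mxblock_diag (K : pzSemiRingType) l n k (A : 'M[K]_(k, n))
    (B : 'M[K]_(n, k)) (T : 'I_l -> 'I_l -> 'M[K]_n) :
  \mxblock_(i < l, j < l) (if i == j then A else 0) *m \mxblock_(i, j) T i j
    *m \mxblock_(i < l, j < l) (if i == j then B else 0) =
  \mxblock_(i, j) (A *m T i j *m B).
Proof.
rewrite !mul_mxblock; apply/eq_mxblock => i j.
rewrite (bigD1 j) //= eqxx [X in _ + X]big1 ?addr0 => [|i' i'j].
  rewrite (bigD1 i) //= eqxx big1 ?addr0 // => i' i'i.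
  by rewrite eq_sym (negPf i'i) mul0mx.
by rewrite (negPf i'j) mulmx0.
Qed.

(** * Positive operators *)

Section PositiveOperators.
Context {R : realType}.
Local Notation C := (Cfield R).

Lemma adjK m n (A : 'M[C]_(m, n)) : adj (adj A) = A.
Proof. exact: trmxCK. Qed.

Lemma adjM m n p (A : 'M[C]_(m, n)) (B : 'M[C]_(n, p)) :
  adj (A *m B) = adj B *m adj A.
Proof. by rewrite /adj trmx_mul map_mxM. Qed.

Lemma adjmx1 n : adj 1%:M = 1%:M :> 'M[C]_n.
Proof. by rewrite /adj trmx1 map_mx1. Qed.

Lemma adjB m n (A B : 'M[C]_(m, n)) : adj (A - B) = adj A - adj B.
Proof. by rewrite /adj linearB map_mxB. Qed.

Lemma adjD m n (A B : 'M[C]_(m, n)) : adj (A + B) = adj A + adj B.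
Proof. by rewrite /adj linearD map_mxD. Qed.

Lemma adjZ m n (c : C) (A : 'M[C]_(m, n)) : adj (c *: A) = c^* *: adj A.
Proof. by rewrite /adj linearZ map_mxZ. Qed.

Lemma adj_delta m n (i : 'I_m) (j : 'I_n) :
  adj (delta_mx i j) = delta_mx j i :> 'M[C]_(n, m).
Proof. by rewrite /adj trmx_delta map_delta_mx. Qed.

Lemma adj_col_mx m1 m2 n (A : 'M[C]_(m1, n)) (B : 'M[C]_(m2, n)) :
  adj (col_mx A B) = row_mx (adj A) (adj B).
Proof. by rewrite /adj tr_col_mx map_row_mx. Qed.

Lemma adj0 m n : adj (0 : 'M[C]_(m, n)) = 0.
Proof. by rewrite /adj trmx0 map_mx0. Qed.

Lemma row_compress n (A T : 'M[C]_n) i :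
  (row i A *m T *m adj (row i A)) 0 0 = (A *m T *m adj A) i i.
Proof.
rewrite -row_mul [LHS]mxE [RHS]mxE; apply: eq_bigr => j _.
by rewrite [row _ _ _ _]mxE 4!mxE [in RHS]mxE [in RHS]mxE.
Qed.

(** Quadratic forms are written as traces against rank-one operators, so that
    linearity of the trace can be used instead of entrywise sums. *)
Lemma quad_trace n (A : 'M[C]_n) (x : 'cV[C]_n) :
  (adj x *m A *m x) 0 0 = \tr (A *m (x *m adj x)).
Proof. by rewrite -trace_mx11 mulmxA -mulmxA mxtrace_mulC. Qed.

Lemma psdP n (A : 'M[C]_n) :
  psd A <-> forall x : 'cV[C]_n, 0 <= \tr (A *m (x *m adj x)).
Proof. by split=> Ap x; [rewrite -quad_trace | rewrite quad_trace]. Qed.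

Lemma psdD n (A B : 'M[C]_n) : psd A -> psd B -> psd (A + B).
Proof.
move=> /psdP Ap /psdP Bp; apply/psdP => x.
by rewrite mulmxDl mxtraceD addr_ge0.
Qed.

Lemma psd_sum n (I : finType) (A : I -> 'M[C]_n) :
  (forall i, psd (A i)) -> psd (\sum_i A i).
Proof.
move=> Ap; apply: (big_ind (@psd R n)); first 1 last.
- exact: psdD.
- by move=> i _; exact: Ap.
- by move=> x; rewrite mulmx0 mul0mx mxE.
Qed.

Lemma psd_congr m n (A : 'M[C]_n) (B : 'M[C]_(m, n)) :
  psd A -> psd (B *m A *m adj B).
Proof. by move=> Ap x; have := Ap (adj B *m x); rewrite adjM adjK !mulmxA. Qed.

Lemma psd1 n : psd (1%:M : 'M[C]_n).
Proof.
move=> x; rewrite mulmx1 mxE sumr_ge0 // => i _.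
by rewrite !mxE mulrC mul_conjC_ge0.
Qed.

Lemma psd_gram m n (B : 'M[C]_(m, n)) : psd (B *m adj B).
Proof. by rewrite -[B in B *m _]mulmx1; apply/psd_congr/psd1. Qed.

Lemma psd_diag_ge0 n (A : 'M[C]_n) i : psd A -> 0 <= A i i.
Proof.
by move=> /(_ (delta_mx i 0)); rewrite adj_delta -rowE -colE !mxE.
Qed.

(** Polarization: the numbers [<e_i + c e_j, A (e_i + c e_j)>] are real for
    [c = 1] and [c = 'i], which forces the (i, j) and (j, i) entries of [A] to be
    conjugate. *)
Lemma psd_hermitian n (A : 'M[C]_n) : psd A -> adj A = A.
Proof.
move=> Ap; apply/matrixP => i j; rewrite !mxE.
have cross (c : C) : c * A i j + c^* * A j i \is Num.real.
  have := ger0_real (Ap (delta_mx i 0 + c *: delta_mx j 0)).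
  rewrite adjD adjZ !adj_delta !mulmxDl !mulmxDr -!scalemxAl -!scalemxAr.
  rewrite -!rowE -!colE !mxE => real_sum.
  have real_diag : A i i + c^* * (c * A j j) \is Num.real.
    rewrite realD ?ger0_real ?psd_diag_ge0 //.
    by rewrite mulrA mulr_ge0 ?psd_diag_ge0 // mulrC mul_conjC_ge0.
  rewrite (_ : _ + _ = (A i i + c * A i j + (c^* * A j i + c^* * (c * A j j)))
                       - (A i i + c^* * (c * A j j))); last by ring.
  exact: realB.
have /CrealP := cross 1; have /CrealP := cross 'i.
rewrite !rmorphD !rmorphM /= !conjCK conjCi rmorph1 !mul1r => imag real.
have {}imag : (A j i)^* - (A i j)^* = A i j - A j i.
  by apply: (mulfI (neq0Ci C)); rewrite !mulrBr -!mulNr -imag addrC.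
have two_neq0 : (2%:R : C) != 0 by rewrite pnatr_eq0.
apply: (mulfI two_neq0).
transitivity (((A i j)^* + (A j i)^*) + ((A j i)^* - (A i j)^*)); first by ring.
by rewrite imag real; ring.
Qed.

Lemma psd_spectral n (A : 'M[C]_n) : psd A ->
  exists (U : 'M[C]_n) (d : 'rV[C]_n),
    [/\ U *m adj U = 1%:M, A = adj U *m diag_mx d *m U
      & forall i, 0 <= d 0 i].
Proof.
move=> Ap; have An : A \is normalmx.
  by apply/normalmxP; rewrite -/(adj A) psd_hermitian.
have U1 := spectral_unitarymx A; have /unitarymxP U2 := U1.
have /orthomx_spectralP := An; rewrite invmx_unitary // => Ae.
exists (spectralmx A), (spectral_diag A); split=> // i.
have := psd_diag_ge0 i (psd_congr (spectralmx A) Ap).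
rewrite [X in _ *m X *m _]Ae /adj !mulmxA U2 mul1mx -mulmxA U2 mulmx1.
by rewrite mxE eqxx.
Qed.

Lemma psd_diag n (d : 'rV[C]_n) : (forall i, 0 <= d 0 i) -> psd (diag_mx d).
Proof.
move=> d_ge0 x; rewrite mul_mx_diag mxE sumr_ge0 // => i _.
by rewrite !mxE mulrAC mulr_ge0 // mulrC mul_conjC_ge0.
Qed.

Lemma psd_trM_ge0 n (A B : 'M[C]_n) : psd A -> psd B -> 0 <= \tr (A *m B).
Proof.
move=> Ap /psd_spectral[U [d [_ -> d_ge0]]].
rewrite mulmxA mxtrace_mulC !mulmxA mul_mx_diag.
apply: sumr_ge0 => i _; rewrite mxE mulr_ge0 //.
exact/psd_diag_ge0/psd_congr.
Qed.

(** The eigenvalues [d] of a positive operator of trace at most 1 lie in [0, 1],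
    where [d - d ^ 2] is nonnegative. *)
Lemma psd_sub_square n (A : 'M[C]_n) : psd A -> \tr A <= 1 -> psd (A - A *m A).
Proof.
move=> /psd_spectral[U [d [UU Ae d_ge0]]] trA.
have d_le1 i : d 0 i <= 1.
  apply: le_trans trA; rewrite Ae mxtrace_mulC mulmxA UU mul1mx mxtrace_diag.
  by rewrite (bigD1 i) //= lerDl sumr_ge0.
have -> : A - A *m A = adj U *m diag_mx (\row_i (d 0 i * (1 - d 0 i))) *m U.
  have -> : A *m A = adj U *m (diag_mx d *m diag_mx d) *m U.
    by rewrite {1 2}Ae !mulmxA -[_ *m U *m _]mulmxA UU mulmx1.
  rewrite {1}Ae -mulmxBl -mulmxBr mulmx_diag -linearB /=.
  rewrite (_ : d - _ = \row_i (d 0 i * (1 - d 0 i))) //.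
  by apply/rowP => i; rewrite !mxE mulrBr mulr1.
rewrite -[X in _ *m X]adjK; apply: psd_congr; apply: psd_diag => i.
by rewrite mxE mulr_ge0 // subr_ge0.
Qed.

(** From [1 - A = (1 - A) ^ 2 + (A - A ^ 2)]. This gives [A <= 1] from products of
    operators alone, so that orthogonal summands need not be diagonalized
    together. *)
Lemma psd_of_sub_square n (A : 'M[C]_n) :
  adj A = A -> psd (A - A *m A) -> psd (1%:M - A).
Proof.
move=> Ah Ap.
have -> : 1%:M - A = (1%:M - A) *m adj (1%:M - A) + (A - A *m A).
  rewrite adjB adjmx1 Ah mulmxBl mul1mx mulmxBr mulmx1 opprB.
  by rewrite !addrA subrK addrK.
by apply: psdD Ap; exact: psd_gram.
Qed.

(** Passing to squares decouples the summands: the square of an orthogonal sum is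
    the sum of the squares, so [psd_of_sub_square] only asks that each [A i]
    dominate its own square. *)
Lemma sum_orthogonal_le1 n (I : finType) (A : I -> 'M[C]_n) :
    (forall i, psd (A i)) -> (forall i, \tr (A i) <= 1) ->
    (forall i j, i != j -> A i *m A j = 0) ->
  loewner (\sum_i A i) 1%:M.
Proof.
move=> Ap trA orth; apply: psd_of_sub_square.
  exact/psd_hermitian/psd_sum.
rewrite sum_orthogonal_square // -sumrB; apply: psd_sum => i.
exact: psd_sub_square.
Qed.

Lemma projection_psd n (P : 'M[C]_n) : projection P -> psd P.
Proof. by case=> PP Ph; rewrite -PP -{2}Ph; exact: psd_gram. Qed.

Lemma projection_compl n (P : 'M[C]_n) :
  projection P -> projection (1%:M - P).
Proof.
case=> PP Ph; split; last by rewrite adjB adjmx1 Ph.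
by rewrite mulmxBl mul1mx mulmxBr mulmx1 PP subrr subr0.
Qed.

Lemma tr_projection_compress_le n (P A : 'M[C]_n) :
  projection P -> psd A -> \tr (P *m A *m P) <= \tr A.
Proof.
move=> Pp Ap; rewrite mxtrace_mulC mulmxA Pp.1 -subr_ge0 -raddfB.
rewrite -[A in A - _]mul1mx -mulmxBl psd_trM_ge0 //.
exact/projection_psd/projection_compl.
Qed.

End PositiveOperators.

(** * Linear bounds on hereditary closed convex hulls *)

(** The field may be complex, where the order is partial and [0 <= z] is the closed
    condition [`|z| = z]. *)
Lemma closed_nneg (K : numFieldType) : closed [set z : K | 0 <= z].
Proof.
have -> : [set z : K | 0 <= z] = (fun z : K => `|z| - z) @^-1` [set 0].
  apply/seteqP; split=> z /=; last by move=> /subr0_eq <-.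
  by move=> /ger0_norm ->; rewrite subrr.
apply: preimage_closed; last first.
  exact/accessible_closed_set1/hausdorff_accessible/norm_hausdorff.
by move=> z _; apply: (@continuousB K K^o K^o); [exact: norm_continuous|].
Qed.

Lemma continuous_trM (K : numFieldType) n (W : 'M[K]_n) :
  continuous (fun A : 'M[K]_n => \tr (A *m W) : K^o).
Proof.
have -> : (fun A : 'M[K]_n => \tr (A *m W)) =
    (fun A => \sum_i \sum_j (A i j * W j i)).
  by apply/funext => A; apply: eq_bigr => i _; rewrite mxE.
apply: continuous_big => [|i _]; first exact: (@add_continuous K^o).
apply: continuous_big => [|j _]; first exact: (@add_continuous K^o).
move=> A; apply: continuousM; last exact: cst_continuous.
exact: coord_continuous.
Qed.

Lemma closed_half_space (K : numFieldType) n (W : 'M[K]_n) (c : K) :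
  closed [set A : 'M[K]_n | \tr (A *m W) <= c].
Proof.
have -> : [set A : 'M[K]_n | \tr (A *m W) <= c] =
    (fun A => c - \tr (A *m W)) @^-1` [set z : K | 0 <= z].
  by apply/seteqP; split=> A /=; rewrite subr_ge0.
apply: preimage_closed; last exact: closed_nneg.
move=> A _; apply: (@continuousB K K^o 'M[K]_n (fun=> c) (fun B => \tr (B *m W))).
  exact: cst_continuous.
exact: continuous_trM.
Qed.

Section ClosedConvexHull.
Context {R : realType}.
Local Notation C := (Cfield R).

(** Half-spaces are closed and convex, and [A |-> \tr (A *m W)] is monotone for the Loewner order
    because [W] is positive. *)
Lemma tr_her_closure_conv_le n (X : set 'M[C]_n) (W : 'M[C]_n) (c : C) :
  psd W -> (forall P, X P -> \tr (P *m W) <= c) ->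
  forall A, her (closure (Defs.conv X)) A -> \tr (A *m W) <= c.
Proof.
move=> Wp Xc A [_ [B XB AB]].
have conv_half_space : Defs.conv X `<=` [set B | \tr (B *m W) <= c].
  move=> _ [m [a [P [a_ge0 a_sum XP ->]]]] /=.
  rewrite mulmx_suml raddf_sum /= -[c]mul1r -a_sum mulr_suml.
  apply: ler_sum => i _; rewrite -scalemxAl mxtraceZ.
  by rewrite ler_wpM2l // Xc.
apply: le_trans (closed_half_space (closureS conv_half_space XB)).
by rewrite -subr_ge0 -raddfB -mulmxBl psd_trM_ge0.
Qed.

End ClosedConvexHull.

(** * Kraus maps *)

Section KrausMaps.
Context {R : realType}.
Local Notation C := (Cfield R).

Definition kraus_map {n k m} (A : 'I_m -> 'M[C]_(k, n)) (T : 'M[C]_n) : 'M[C]_k :=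
  \sum_p A p *m T *m adj (A p).

Lemma psd_kraus_map n k m (A : 'I_m -> 'M[C]_(k, n)) (T : 'M[C]_n) :
  psd T -> psd (kraus_map A T).
Proof. by move=> Tp; apply: psd_sum => p; exact: psd_congr. Qed.

Lemma kraus_map_sum n k m (A : 'I_m -> 'M[C]_(k, n)) (I : finType)
    (T : I -> 'M[C]_n) :
  kraus_map A (\sum_i T i) = \sum_i kraus_map A (T i).
Proof.
rewrite /kraus_map exchange_big /=; apply: eq_bigr => p _.
by rewrite mulmx_sumr mulmx_suml.
Qed.

(** In the product of the two images, the factors between [S] and [T] are exactly
    the generators [A_p^* A_q] of the Kraus space. *)
Lemma kraus_map_orthogonal n k m (A : 'I_m -> 'M[C]_(k, n)) (S T : 'M[C]_n) :
  (forall p q, S *m (adj (A p) *m A q) *m T = 0) ->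
  kraus_map A S *m kraus_map A T = 0.
Proof.
move=> ST0; rewrite /kraus_map mulmx_suml; apply: big1 => p _.
rewrite mulmx_sumr; apply: big1 => q _.
transitivity (A p *m (S *m (adj (A p) *m A q) *m T) *m adj (A q)).
  by rewrite !mulmxA.
by rewrite ST0 mulmx0 mul0mx.
Qed.

Lemma mem_kraus_space n k m (A : 'I_m -> 'M[C]_(k, n)) p q :
  adj (A p) *m A q \in kraus_space A.
Proof.
by apply: memv_span; apply: allpairs_f; rewrite mem_enum.
Qed.

(** The adjoint of [kraus_map A] for the trace pairing (the Heisenberg picture). *)
Definition kraus_dual {n k m} (A : 'I_m -> 'M[C]_(k, n)) (Y : 'M[C]_k) :
    'M[C]_n :=
  \sum_p adj (A p) *m Y *m A p.

Lemma psd_kraus_dual n k m (A : 'I_m -> 'M[C]_(k, n)) (Y : 'M[C]_k) :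
  psd Y -> psd (kraus_dual A Y).
Proof.
move=> Yp; apply: psd_sum => p.
by rewrite -[X in _ *m X]adjK; exact: psd_congr.
Qed.

Lemma tr_kraus_map n k m (A : 'I_m -> 'M[C]_(k, n)) T Y :
  \tr (kraus_map A T *m Y) = \tr (T *m kraus_dual A Y).
Proof.
rewrite mulmx_suml mulmx_sumr !raddf_sum /=; apply: eq_bigr => p _.
by rewrite -!mulmxA mxtrace_mulC !mulmxA.
Qed.

Fact kraus_map_is_linear n k m (A : 'I_m -> 'M[C]_(k, n)) :
  linear (kraus_map A).
Proof.
move=> a T T'; rewrite /kraus_map scaler_sumr -big_split; apply: eq_bigr => p _.
by rewrite mulmxDr mulmxDl -scalemxAr -scalemxAl.
Qed.

HB.instance Definition _ n k m (A : 'I_m -> 'M[C]_(k, n)) :=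
  GRing.isLinear.Build C 'M[C]_n 'M[C]_k _ (kraus_map A)
    (kraus_map_is_linear A).

(** Applying [A p] blockwise is conjugation by the block diagonal matrix [D] with
    [A p] on the diagonal. *)
Lemma kraus_map_cp n k m (A : 'I_m -> 'M[C]_(k, n)) :
  completely_positive (kraus_map A).
Proof.
move=> l T Tp; rewrite mxblock_sum; apply: psd_sum => p.
pose D := \mxblock_(i < l, j < l) (if i == j then A p else 0).
have adj_D : adj D = \mxblock_(i < l, j < l) (if i == j then adj (A p) else 0).
  rewrite /adj tr_mxblock; apply/matrixP => i j; rewrite !mxE.
  by rewrite eq_sym; case: eqP => _; rewrite !mxE ?rmorph0.
suff -> : \mxblock_(i, j) (A p *m T i j *m adj (A p)) =
    D *m \mxblock_(i, j) T i j *m adj D by exact: psd_congr.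
by rewrite adj_D mul_mxblock_diag.
Qed.

Lemma kraus_map_channel n k m (A : 'I_m -> 'M[C]_(k, n)) :
  \sum_p adj (A p) *m A p = 1%:M -> quantum_channel (kraus_map A).
Proof.
move=> A1; split; first exact: kraus_map_cp.
move=> T; rewrite -[in RHS](mul1mx T) -A1 mulmx_suml !raddf_sum /=.
by apply: eq_bigr => p _; rewrite mxtrace_mulC mulmxA.
Qed.

End KrausMaps.

(** * Abelian projections *)

Local Open Scope sesquilinear_scope.

(** A unitary that triangularizes a commuting family closed under adjoints makes
    each [A] and its adjoint triangular on the same side, hence [A] diagonal. *)
Lemma simultaneous_diagonalization (K : numClosedFieldType) n (As : seq 'M[K]_n) :
    {in As &, forall A B, A *m B = B *m A} ->
    {in As, forall A, A ^t* \in As} ->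
  exists2 U : 'M[K]_n, U *m U ^t* = 1%:M &
    {in As, forall A, is_diag_mx (U *m A *m U ^t*)}.
Proof.
move=> comm adj_closed; have [U Uu /allP UAs] := cotrigonalization comm.
have trig A : A \in As -> is_trig_mx (U *m A *m U ^t*).
  by move=> /UAs /=; rewrite /similar_to conjymx.
exists U => [|A AAs]; first exact/unitarymxP.
apply/is_diag_mxP => i j; rewrite neq_ltn => /orP[] ij.
  exact: (is_trig_mxP (trig _ AAs)).
have /is_trig_mxP/(_ _ _ ij) := trig _ (adj_closed _ AAs).
have -> : U *m A ^t* *m U ^t* = (U *m A *m U ^t*) ^t*.
  by rewrite !trmx_mul !map_mxM /= trmxCK mulmxA.
by rewrite mxE [in X in X = _]mxE => /eqP; rewrite conjC_eq0 => /eqP.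
Qed.

Local Close Scope sesquilinear_scope.

Section AbelianProjections.
Context {R : realType}.
Local Notation C := (Cfield R).

(** The [Q j] are the rank-one projections on the vectors of a basis that
    diagonalizes the whole family. *)
Lemma orthogonal_resolution n (As : seq 'M[C]_n) :
    {in As &, forall A B, A *m B = B *m A} ->
    {in As, forall A, adj A \in As} ->
  exists Q : 'I_n -> 'M[C]_n,
    [/\ forall j, psd (Q j), forall j, \tr (Q j) = 1, \sum_j Q j = 1%:M
      & {in As, forall A i j, i != j -> Q i *m A *m Q j = 0}].
Proof.
move=> comm adj_closed.
have [U Uu diagU] := simultaneous_diagonalization comm adj_closed.
have {}Uu : U *m adj U = 1%:M := Uu.
exists (fun j => adj U *m delta_mx j j *m U); split.
- move=> j; have := psd_gram (adj U *m delta_mx j (0 : 'I_1)).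
  rewrite adjM adjK adj_delta -mulmxA [delta_mx j 0 *m _]mulmxA.
  by rewrite mul_delta_mx mulmxA.
- by move=> j; rewrite mxtrace_mulC mulmxA Uu mul1mx -(mul_delta_mx (0 : 'I_1))
     mxtrace_mulC mul_delta_mx trace_mx11 mxE.
- rewrite -mulmx_suml -mulmx_sumr.
  by rewrite sum_delta_mx mulmx1 (mulmx1C Uu).
- move=> A AAs i j ij; have /is_diag_mxP D := diagU A AAs.
  have E0 : delta_mx i i *m (U *m A *m adj U) *m delta_mx j j = 0.
    rewrite -(mul_delta_mx (0 : 'I_1) i i) -(mul_delta_mx (0 : 'I_1) j j).
    transitivity (delta_mx i (0 : 'I_1) *m (delta_mx (0 : 'I_1) i
      *m (U *m A *m adj U) *m delta_mx j (0 : 'I_1)) *m delta_mx (0 : 'I_1) j).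
      by rewrite !mulmxA.
    rewrite (_ : delta_mx 0 i *m _ *m _ = 0) ?mulmx0 ?mul0mx //.
    by rewrite -rowE -colE; apply/matrixP => r s; rewrite mxE [LHS]mxE D // mxE.
  transitivity
    (adj U *m (delta_mx i i *m (U *m A *m adj U) *m delta_mx j j) *m U).
    by rewrite !mulmxA.
  by rewrite E0 mulmx0 mul0mx.
Qed.

(** Each state [P Q_j P] comes from a single basis vector, and distinct ones have
    orthogonal images because [Q_i] and [Q_j] cut off-diagonal blocks of the
    diagonal operators [P A_p^* A_q P]. *)
Lemma kraus_map_abelian_le1 n k m (S : {vspace 'M[C]_n})
    (A : 'I_m -> 'M[C]_(k, n)) (P : 'M[C]_n) :
    abelian_projection S P -> (kraus_space A <= S)%VS ->
    (forall T, \tr (kraus_map A T) = \tr T) ->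
  loewner (kraus_map A P) 1%:M.
Proof.
move=> [Pp [D [_ commD] PSPD]] /subvP AS tpA.
pose X p q := P *m (adj (A p) *m A q) *m P.
have XD p q : D (X p q).
  by apply: PSPD; exists (adj (A p) *m A q) => //=; exact/AS/mem_kraus_space.
pose Xs := [seq X p q | p <- enum 'I_m, q <- enum 'I_m].
have Xs_mem p q : X p q \in Xs by apply: allpairs_f; rewrite mem_enum.
have [||Q [Qp trQ sumQ orthQ]] := @orthogonal_resolution n Xs.
- by move=> _ _ /allpairsP[pq [_ _ ->]] /allpairsP[pq' [_ _ ->]]; exact: commD.
- move=> _ /allpairsP[pq [_ _ ->]].
  by rewrite /X !adjM adjK Pp.2 mulmxA Xs_mem.
have -> : P = \sum_j P *m Q j *m P.
  by rewrite -mulmx_suml -mulmx_sumr sumQ mulmx1 Pp.1.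
rewrite kraus_map_sum; apply: sum_orthogonal_le1.
- move=> j; apply: psd_kraus_map; rewrite -{2}Pp.2; exact: psd_congr.
- by move=> j; rewrite tpA -(trQ j); exact: tr_projection_compress_le.
- move=> i j ij; apply: kraus_map_orthogonal => p q.
  transitivity (P *m (Q i *m X p q *m Q j) *m P); first by rewrite !mulmxA.
  by rewrite orthQ // mulmx0 mul0mx.
Qed.

Lemma ap_sub_th n (S : {vspace 'M[C]_n}) : ap S `<=` th S.
Proof.
move=> A apA; split; first exact: apA.1.
move=> k Phi [[_ tpPhi] [m [B [PhiB BS]]]].
have {}PhiB T : Phi T = kraus_map B T := PhiB T.
have compl T (Y : 'M[C]_k) :
    \tr ((1%:M - Phi T) *m Y) = \tr Y - \tr (T *m kraus_dual B Y).
  by rewrite mulmxBl mul1mx raddfB /= PhiB tr_kraus_map.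
apply/psdP => x; rewrite compl subr_ge0.
apply: tr_her_closure_conv_le apA => [|P Pab].
  exact/psd_kraus_dual/psd_gram.
rewrite -subr_ge0 -compl; move: x; apply/psdP.
rewrite PhiB; apply: (kraus_map_abelian_le1 Pab BS) => T.
by rewrite -tpPhi PhiB.
Qed.

End AbelianProjections.

(** * Full projections *)

Section FullProjections.
Context {R : realType}.
Local Notation C := (Cfield R).

(** Kraus operators of [T |-> \tr (P T) (+) (1 - P) T (1 - P)]. Row [i] of [P] is
    [e_i^* P], and the sum of [<e_i, P T P e_i>] is [\tr (P T)]; using the rows of
    [P] avoids choosing an orthonormal basis of the range of [P]. The last operator
    lands in a summand orthogonal to the first coordinate, so no cross terms between
    [P] and [1 - P] enter the Kraus space. *)
Definition full_kraus_op n (P : 'M[C]_n) (s : 'I_n + 'I_1) : 'M[C]_(1 + n, n) :=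
  match s with
  | inl i => col_mx (row i P) 0
  | inr _ => col_mx 0 (1%:M - P)
  end.

Definition full_kraus n (P : 'M[C]_n) (p : 'I_(n + 1)) : 'M[C]_(1 + n, n) :=
  full_kraus_op P (fintype.split p).

Lemma full_kraus_op_gram n (P : 'M[C]_n) (s t : 'I_n + 'I_1) : projection P ->
  adj (full_kraus_op P s) *m full_kraus_op P t =
  match s, t with
  | inl i, inl j => P *m delta_mx i j *m P
  | inr _, inr _ => 1%:M - P
  | _, _ => 0
  end.
Proof.
move=> Pp; have [QQ Qh] := projection_compl Pp; case: Pp => PP Ph.
case: s => i; case: t => j;
  rewrite adj_col_mx mul_row_col ?adj0 ?mul0mx ?mulmx0 ?addr0 ?add0r //.
  by rewrite !rowE adjM adj_delta Ph -(mul_delta_mx (0 : 'I_1) i j) !mulmxA.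
by rewrite Qh.
Qed.

Lemma sum_full_kraus n (P : 'M[C]_n) : projection P ->
  \sum_p adj (full_kraus P p) *m full_kraus P p = 1%:M.
Proof.
move=> Pp.
rewrite (sum_ord_addn1 (fun s => adj (full_kraus_op P s) *m full_kraus_op P s)).
rewrite full_kraus_op_gram //.
under eq_bigr do rewrite full_kraus_op_gram //.
rewrite -mulmx_suml -mulmx_sumr sum_delta_mx mulmx1 Pp.1.
by rewrite addrC subrK.
Qed.

Lemma full_kraus_space n (S : {vspace 'M[C]_n}) (P : 'M[C]_n) :
  1%:M \in S -> full_projection S P -> (kraus_space (full_kraus P) <= S)%VS.
Proof.
move=> S1 [Pp PS]; apply/span_subvP => _ /allpairsP[[p q] [_ _ ->]] /=.
have compress A : P *m A *m P \in S by apply: (PS (P *m A *m P)); exists A.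
rewrite full_kraus_op_gram //.
case: fintype.split => i; case: fintype.split => j;
  [exact: compress | exact: mem0v | exact: mem0v |].
by apply: memvB => //; rewrite -Pp.1 -[X in X *m P]mulmx1.
Qed.

Lemma th_full_le1 n (S : {vspace 'M[C]_n}) (P T : 'M[C]_n) :
  1%:M \in S -> full_projection S P -> th S T -> \tr (P *m T) <= 1.
Proof.
move=> S1 Pf [_ /(_ _ (kraus_map (full_kraus P)))] /(_ _) le1.
have {}le1 : loewner (kraus_map (full_kraus P) T) 1%:M.
  apply: le1; split; first exact/kraus_map_channel/sum_full_kraus/Pf.1.
  exists (n + 1)%N, (full_kraus P); split=> //; exact: full_kraus_space.
have := psd_diag_ge0 (lshift n 0) le1.
rewrite mxE [X in 0 <= _ + X]mxE [X in 0 <= X - _]mxE eqxx subr_ge0.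
suff -> : kraus_map (full_kraus P) T (lshift n 0) (lshift n 0) = \tr (P *m T).
  by [].
rewrite summxE (sum_ord_addn1 (fun s => (full_kraus_op P s *m T
  *m adj (full_kraus_op P s)) (lshift n 0) (lshift n 0))).
rewrite /= adj_col_mx mul_col_mx mul_col_row block_mxEul !mul0mx mxE addr0.
case: Pf.1 => PP Ph.
rewrite -[in RHS]PP -mulmxA mxtrace_mulC; apply: eq_bigr => i _.
rewrite adj_col_mx mul_col_mx mul_col_row block_mxEul.
by rewrite row_compress Ph.
Qed.

Lemma th_sub_sharp_fp n (S : {vspace 'M[C]_n}) :
  operator_system S -> th S `<=` sharp (fp S).
Proof.
move=> [S1 _] T thT; split=> [|A]; first exact: thT.1.
apply: tr_her_closure_conv_le => [|P Pf]; first exact: thT.1.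
exact: th_full_le1 S1 Pf thT.
Qed.

End FullProjections.

(** * The sandwich inequality *)

Lemma theta_set_mono (R : realType) n (X Y : set 'M[Cfield R]_n) :
  X `<=` Y -> (theta_set X <= theta_set Y)%E.
Proof. by move=> XY; apply/ereal_sup_le/image_subset. Qed.

Theorem corollary4p8 (R : realType) (n : nat) (S : {vspace 'M[Cfield R]_n}) :
  operator_system S ->
  (alpha S <= theta S)%E /\ (theta S <= phi S)%E.
Proof.
move=> opS; split; apply: theta_set_mono; first exact: ap_sub_th.
exact: th_sub_sharp_fp.
Qed.
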